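(* Let $u_0,\rho_0,u_B,\rho_B:[0,\infty)\to\mathbb{R}$ be bounded measurable functions, and suppose that $\rho_0$ is integrable on $[0,\infty)$. Then there exists a weak asymptotic solution $(u^\epsilon,\rho^\epsilon)_{\epsilon>0}$, in the sense of the definition given in the context, to the system $$u_t+\left(\frac{u^2}{2}\right)_x=0,\qquad \rho_t+(\rho u)_x=0,\qquad x>0,\ t>0,$$ with initial conditions $u(x,0)=u_0(x)$, $\rho(x,0)=\rho_0(x)$ for $x>0$, and boundary conditions $u(0,t)=u_B(t)$, $\rho(0,t)=\rho_B(t)$ for $t>0$.
   Context: Definition (weak asymptotic solution). A family of smooth real-valued functions $(u^\epsilon,\rho^\epsilon)_{\epsilon>0}$ of $(x,t)\in[0,\infty)\times[0,\infty)$ is called a weak asymptotic solution to the system $u_t+(u^2/2)_x=0$, $\rho_t+(\rho u)_x=0$ with initial conditions $u(x,0)=u_0(x)$, $\rho(x,0)=\rho_0(x)$ and boundary conditions $u(0,t)=u_B(t)$, $\rho(0,t)=\rho_B(t)$ provided that the following two conditions hold. (i) As $\epsilon\to0$, for all $\phi\in C_c^\infty(0,\infty)$, $$\int_0^\infty\big(u^\epsilon_t(x,t)+u^\epsilon(x,t)u^\epsilon_x(x,t)\big)\phi(x)\,dx=o(\epsilon),$$ $$\int_0^\infty\big(\rho^\epsilon_t(x,t)+(\rho^\epsilon(x,t)u^\epsilon(x,t))_x\big)\phi(x)\,dx=o(\epsilon),$$ where these estimates are required to hold uniformly in $t\in[0,T]$ for each $T>0$. (ii) As $\epsilon\to0$,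 for all $\psi\in C_c^\infty(0,\infty)$, $$\int_0^\infty(u^\epsilon(x,0)-u_0(x))\psi(x)\,dx=o(\epsilon),\qquad \int_0^\infty(\rho^\epsilon(x,0)-\rho_0(x))\psi(x)\,dx=o(\epsilon),$$ $$\int_0^\infty(u^\epsilon(0,t)-u_B(t))\psi(t)\,dt=o(\epsilon),\qquad \int_0^\infty(\rho^\epsilon(0,t)-\rho_B(t))\psi(t)\,dt=o(\epsilon).$$ *)

(* Defs.v *)
From HB Require Import structures.
From mathcomp Require Import all_boot all_order all_algebra.
From mathcomp Require Import all_classical all_reals all_analysis.

Set Implicit Arguments.
Unset Strict Implicit.
Unset Printing Implicit Defensive.
Import Order.TTheory GRing.Theory Num.Theory.
Import numFieldNormedType.Exports.

Local Open Scope classical_set_scope.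
Local Open Scope ring_scope.

(* Functions on the half-line [0, +oo[ (resp. on the closed quadrant) are
   represented by total functions on R (resp. on R * R); none of the notions
   below depends on the values taken outside that set. *)

Definition halfline (R : realType) : set R := `[0, +oo[.
Definition quadrant (R : realType) : set (R * R) := @halfline R `*` @halfline R.

Section HalflineDerivative.
Context {R : realType}.
Implicit Types (g : R -> R) (x : R).

(* Difference quotients at x between points of [0, +oo[: the limit is the
   ordinary derivative if 0 < x and the right derivative if x = 0. *)
Definition slopes g x : set_system R :=
  (g y - g x) / (y - x) @[y --> within (@halfline R) x^'].
Definition hderivable g x : Prop := cvg (slopes g x).
Definition hderive g x : R := lim (slopes g x).

End HalflineDerivative.

Section Smoothness.
Context {R : realType}.
Implicit Types (f : R * R -> R) (p : R * R).

(* The points of R * R are written (x, t). *)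
Definition x_derivable f p : Prop := hderivable (fun x => f (x, p.2)) p.1.
Definition t_derivable f p : Prop := hderivable (fun t => f (p.1, t)) p.2.
Definition dx f p : R := hderive (fun x => f (x, p.2)) p.1.
Definition dt f p : R := hderive (fun t => f (p.1, t)) p.2.

Fixpoint C_quadrant (n : nat) f : Prop :=
  {within @quadrant R, continuous f} /\
  if n is m.+1 then
    [/\ forall p, quadrant p -> x_derivable f p,
        forall p, quadrant p -> t_derivable f p,
        C_quadrant m (dx f) & C_quadrant m (dt f)]
  else True.

Definition smooth_quadrant f : Prop := forall n, C_quadrant n f.

(* C_c^oo(]0, +oo[), each function being extended by 0 to R. *)
Definition test_function (phi : R -> R) : Prop :=
  [/\ forall n x, derivable (derive1n n phi) x 1,
      compact (closure [set x | phi x != 0]) &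
      closure [set x | phi x != 0] `<=` `]0, +oo[].

End Smoothness.

(* The library equips R itself with the Borel sigma-algebra. LebesgueR R is R
   with the sigma-algebra of Lebesgue measurable sets, on which
   completed_lebesgue_measure is defined. *)
Notation LebesgueR R := (caratheodory_type (wlength (@idfun R))^*%mu).

Definition lebesgue_measurable_fun (R : realType) (D : set R) (f : R -> R) :
    Prop :=
  measurable_fun (D : set (LebesgueR R)) (f : LebesgueR R -> R).

Definition lebesgue_integrable (R : realType) (D : set R) (f : R -> R) : Prop :=
  (@completed_lebesgue_measure R).-integrable D (EFin \o f).

Definition hintegral (R : realType) (f : R -> R) : R :=
  \int[@completed_lebesgue_measure R]_(x in @halfline R) f x.

Definition uniform_littleo (R : realType) (A : set R) (F : R -> R -> R) : Prop :=
  forall d : R, 0 < d ->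
    \forall e \near 0^'+, forall t, A t -> `|F e t| <= d * `|e|.

Definition weak_asymptotic_solution (R : realType)
    (u rho : R -> R * R -> R) (u0 rho0 uB rhoB : R -> R) : Prop :=
  [/\ forall e : R, 0 < e -> smooth_quadrant (u e) /\ smooth_quadrant (rho e),
      forall phi, test_function phi -> forall T : R, 0 < T ->
        uniform_littleo `[0, T] (fun e t => hintegral (fun x =>
          (dt (u e) (x, t) + u e (x, t) * dx (u e) (x, t)) * phi x)),
      forall phi, test_function phi -> forall T : R, 0 < T ->
        uniform_littleo `[0, T] (fun e t => hintegral (fun x =>
          (dt (rho e) (x, t) + dx (rho e \* u e) (x, t)) * phi x)),
      forall psi, test_function psi ->
        (fun e => hintegral (fun x => (u e (x, 0) - u0 x) * psi x))
          =o_ (0^'+) id /\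
        (fun e => hintegral (fun x => (rho e (x, 0) - rho0 x) * psi x))
          =o_ (0^'+) id &
      forall psi, test_function psi ->
        (fun e => hintegral (fun t => (u e (0, t) - uB t) * psi t))
          =o_ (0^'+) id /\
        (fun e => hintegral (fun t => (rho e (0, t) - rhoB t) * psi t))
          =o_ (0^'+) id].

(* Main.v *)
Require Import Defs.
From HB Require Import structures.
From mathcomp Require Import all_boot all_order all_algebra.
From mathcomp Require Import all_classical all_reals all_analysis.
From mathcomp Require Import measurable_realfun.
From mathcomp Require Import ring lra.
Import Order.TTheory GRing.Theory Num.Theory.
Import numFieldNormedType.Exports.

Local Open Scope classical_set_scope.
Local Open Scope ring_scope.

(** The residuals are only paired with fixed test functions, whose supports stay
    away from the axis [x = 0], and no strong limit is asked for. This leaves room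
    for a family which is stationary outside a thin boundary layer and whose
    fluxes are weakly constant because the family oscillates.

    Cut the half-line into cells [k h <= x < (k + 1) h] with [h = e ^ 3], and use
    the first [n] of them, where [1 / e <= n h <= 2 / e] for [e <= 1]. Let [b] be a
    smooth bump supported in the unit interval, and on the k-th cell put
      [v = A_k b + D_k b'],   [r = B_k b + E_k b'],
    all at [x / h - k] ([bump_train]). As [b] vanishes at both ends, [b'] has
    integral zero and is orthogonal to [b]. So the means of [v] and [r] over a cell
    depend on [A_k] and [B_k] only, which are chosen to reproduce the means of [u0]
    and [rho0]. The coefficients [D_k] and [E_k] are still free: [D_k] makes the
    mean of [v ^ 2] equal to one constant [C] on all cells ([sqr_swing]), and [E_k]
    makes the mean of [r v] vanish ([counterswing_balance]). Since [C] is taken so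
    large that [D_k >= 1], all these coefficients are bounded independently of [e].

    Hence [v - u0], [r - rho0], [v ^ 2 - C] and [r v] are uniformly bounded and have
    mean zero on every cell. Paired with a Lipschitz function that vanishes beyond
    [n h], such a function contributes at most a constant times [h] per unit of
    length, hence [O(h * n h) = O(e ^ 2)] in total ([pairing_le]). This settles
    the initial conditions, and after an integration by parts also both equations
    for the stationary pair, because [v v_x] is the derivative of [(v ^ 2 - C) / 2].

    The boundary values are put in by adding [layer h x * w t], where [w] is the
    bump train with the cell means of [uB] or [rhoB] and [layer h] equals 1 at
    [x = 0] and vanishes for [x >= h]. A test function in [x] does not see this
    term as soon as [h] is smaller than the distance of its support from 0, and
    the two terms do not interfere in the traces, since bump trains vanish at 0.

    The pieces belong to a class of functions stable under derivation
    ([elementary]), so that smoothness on the quadrant holds for all orders at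
    once ([tensor_C_quadrant]). *)

Set Implicit Arguments.
Unset Strict Implicit.
Unset Printing Implicit Defensive.

(** * A class of smooth functions containing a bump *)

Section Elementary.
Context {R : realType}.
Implicit Types (f g : R -> R) (p : {poly R}) (x : R).

(** The flat function exp (- 1 / x), with a polynomial factor in [1 / x] that
    makes the family stable under derivation. *)
Definition flat p x : R := if 0 < x then p.[x^-1] * expR (- x^-1) else 0.

(** Each monomial is dominated by the term of the same degree in the exponential
    series. *)
Lemma horner_expRN_bounded p :
  exists2 C : R, 0 < C & forall y, 0 <= y -> `|p.[y] * expR (- y)| <= C.
Proof.
have mono n y : 0 <= y -> `|y ^+ n * expR (- y)| <= n`!%:R.
  move=> y0; rewrite ger0_norm ?mulr_ge0 ?exprn_ge0 ?expR_ge0//.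
  case: n => [|n].
    by rewrite expr0 mul1r fact0 -expR0 ler_expR oppr_le0.
  rewrite expRN ler_pdivrMr ?expR_gt0// -ler_pdivrMl ?ltr0n ?fact_gt0//.
  by apply: le_trans (expR_ge1Dxn n y0); rewrite mulrC lerDr.
exists (1 + \sum_(i < size p) `|p`_i| * i`!%:R) => [|y y0].
  by rewrite ltr_pwDl// sumr_ge0// => i _; rewrite mulr_ge0.
rewrite horner_coef mulr_suml (le_trans (ler_norm_sum _ _ _))//.
rewrite ler_wpDl// ler_sum// => i _.
by rewrite -mulrA normrM ler_wpM2l// mono.
Qed.

Lemma flat_le0 p x : x <= 0 -> flat p x = 0.
Proof. by rewrite /flat ltNge => ->. Qed.

(** For [0 < x] this is the product rule in the variable [1 / x]. At 0 the
    exponential beats every power of [1 / x], whence a bound [C * x ^ 2]. *)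
Lemma is_derive_flat p x :
  is_derive x 1 (flat p) (flat ('X ^+ 2 * (p - p^`())) x).
Proof.
have [x0|x0|->] := ltgtP x 0.
- rewrite flat_le0 ?ltW//; apply: (@near_eq_is_derive _ _ _ (cst 0)).
    by near=> y; rewrite /= flat_le0// ltW//; near: y; exact: lt_nbhsl.
- have invx : is_derive x 1 (fun y : R => y^-1) (- x ^- 2).
    apply: DeriveDef; first by apply: derivableV; rewrite ?gt_eqF.
    by rewrite deriveV ?gt_eqF// derive_id /GRing.scale/= mulr1.
  have expx : is_derive x 1 (fun y : R => expR (- y^-1)) (expR (- x^-1) * x ^- 2).
    apply: (@is_derive1_comp _ expR (fun y : R => - y^-1)).
    by rewrite -[X in is_derive _ _ _ X]opprK; apply: is_deriveN.
  have polx : is_derive x 1 (fun y : R => p.[y^-1]) (p^`().[x^-1] * - x ^- 2).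
    exact: (@is_derive1_comp _ (horner p) (fun y : R => y^-1)).
  apply: (@near_eq_is_derive _ _ _ (fun y : R => p.[y^-1] * expR (- y^-1) : R)).
    by near=> y; rewrite /flat ifT//; near: y; apply: lt_nbhsr.
  apply: is_derive_eq; rewrite /flat x0 !hornerE /GRing.scale/=.
  by rewrite exprVn; ring.
- rewrite flat_le0//.
  have [C C0 hC] := horner_expRN_bounded ('X ^+ 2 * p).
  have bnd h : `|flat p h| <= C * h ^+ 2.
    have [h0|h0] := leP h 0.
      by rewrite flat_le0// normr0 mulr_ge0 ?sqr_ge0// ltW.
    have hC0 := hC h^-1; rewrite invr_ge0 ltW// in hC0; have {hC0} := hC0 isT.
    set b := C * _; rewrite !hornerE -mulrA normrM exprVn normrV;
      last by rewrite unitfE sqrf_eq0 gt_eqF.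
    rewrite (ger0_norm (sqr_ge0 h)) mulrC ler_pdivrMr ?exprn_gt0//.
    by rewrite /flat h0.
  have cv : h^-1 *: ((flat p \o shift 0) (h *: 1) - flat p 0) @[h --> 0^'] --> (0 : R).
    apply/cvgr0Pnorm_le => _/posnumP[e]; near=> h.
    have h0 : h != 0 by near: h; exact: nbhs_dnbhs_neq.
    rewrite /= (flat_le0 _ (lexx _)) subr0 addr0 /GRing.scale/= mulr1.
    rewrite normrM normfV ler_pdivrMl ?normr_gt0//.
    apply: le_trans (bnd _) _; rewrite -real_normK ?num_real// expr2.
    rewrite mulrCA ler_wpM2l// -ler_pdivlMl//.
    by near: h; apply: dnbhs0_le; rewrite mulr_gt0 ?invr_gt0.
  apply: DeriveDef; first by apply/cvg_ex; exists 0.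
  exact: cvg_lim cv.
Unshelve. all: by end_near. Qed.

(** Stability under derivation of this class ([elementary_derive]) replaces a
    separate bookkeeping of the derivatives of each order. *)
Inductive elementary : (R -> R) -> Prop :=
| elementary_cst c : elementary (fun=> c)
| elementary_flat p : elementary (flat p)
| elementaryD f g of elementary f & elementary g :
    elementary (fun x => f x + g x)
| elementaryM f g of elementary f & elementary g :
    elementary (fun x => f x * g x)
| elementary_affine a b f of elementary f :
    elementary (fun x => f (a * x + b)).

Lemma elementary_derive f : elementary f ->
  exists2 df, elementary df & forall x, is_derive x 1 f (df x).
Proof.
elim=> {f} [c|p|f g _ [df edf f'] _ [dg edg g']
  |f g ef [df edf f'] eg [dg edg g']|a b f _ [df edf f']].
- exists (fun=> 0); first exact: elementary_cst.
  by move=> x; exact: is_derive_cst.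
- exists (flat ('X ^+ 2 * (p - p^`()))); first exact: elementary_flat.
  exact: is_derive_flat.
- exists (fun x => df x + dg x); first exact: elementaryD.
  by move=> x; exact: is_deriveD.
- exists (fun x => f x * dg x + g x * df x).
    by apply: elementaryD; apply: elementaryM.
  by move=> x; exact: is_deriveM.
- exists (fun x => a * df (a * x + b)).
    by apply: elementaryM; [exact: elementary_cst|exact: elementary_affine].
  move=> x; rewrite mulrC; apply: (@is_derive1_comp _ f (fun x => a * x + b)).
  by apply: is_derive_eq; rewrite /GRing.scale/=; ring.
Qed.

Lemma elementary_is_derive f x : elementary f -> is_derive x 1 f (derive1 f x).
Proof.
by move=> /elementary_derive[df _ /(_ x) f'];
  rewrite derive1E; apply: DeriveDef; first exact: ex_derive.
Qed.

Lemma elementary_derive1 f : elementary f -> elementary (derive1 f).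
Proof.
move=> /elementary_derive[df edf f'].
suff -> : derive1 f = df by [].
by apply/funext => x; rewrite derive1E; apply: derive_val.
Qed.

Lemma elementary_continuous f : elementary f -> continuous f.
Proof.
move=> ef x; apply: differentiable_continuous; apply/derivable1_diffP.
by have := elementary_is_derive x ef; move=> /@ex_derive.
Qed.

Lemma elementary_sum n (F : 'I_n -> R -> R) : (forall i, elementary (F i)) ->
  elementary (fun x => \sum_(i < n) F i x).
Proof.
elim: n F => [|n IH] F eF.
  rewrite (_ : (fun _ => _) = fun=> 0); first exact: elementary_cst.
  by apply/funext => x; rewrite big_ord0.
rewrite (_ : (fun _ => _) =
    fun x => \sum_(i < n) F (widen_ord (leqnSn n) i) x + F ord_max x).
  by apply: elementaryD; [exact: IH|].
by apply/funext => x; rewrite big_ord_recr.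
Qed.

Definition bump01 x : R := flat 1 x * flat 1 (- 1 * x + 1).

Lemma elementary_bump : elementary bump01.
Proof.
by apply: elementaryM; [|apply: elementary_affine]; exact: elementary_flat.
Qed.

Lemma bump_out x : x <= 0 \/ 1 <= x -> bump01 x = 0.
Proof.
rewrite /bump01 => -[x0|x1]; first by rewrite flat_le0 ?mul0r.
have y0 : - 1 * x + 1 <= 0 by lra.
by rewrite (flat_le0 _ y0) mulr0.
Qed.

Lemma bump_ge0 x : 0 <= bump01 x.
Proof.
have f0 y : 0 <= flat 1 y.
  by rewrite /flat; case: ifP => // _; rewrite hornerE mul1r expR_ge0.
by rewrite /bump01 mulr_ge0.
Qed.

Lemma bump_half : 0 < bump01 2^-1.
Proof.
have f0 y : 0 < y -> 0 < flat 1 y.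
  by move=> y0; rewrite /flat y0 hornerE mul1r expR_gt0.
by apply: mulr_gt0; apply: f0; lra.
Qed.

Lemma dbump_out x : x <= 0 \/ 1 <= x -> derive1 bump01 x = 0.
Proof.
suff -> : derive1 bump01 x = flat 1 x * (- flat ('X ^+ 2 * (1 - 1^`())) (- 1 * x + 1))
    + flat 1 (- 1 * x + 1) * flat ('X ^+ 2 * (1 - 1^`())) x.
  case=> [x0|x1]; first by rewrite !(@flat_le0 _ x)// mul0r mulr0 addr0.
  have y0 : - 1 * x + 1 <= 0 by lra.
  by rewrite !(@flat_le0 _ (- 1 * x + 1))// oppr0 mul0r mulr0 addr0.
rewrite derive1E; apply: derive_val; apply: is_deriveM; first exact: is_derive_flat.
rewrite -[X in is_derive _ _ _ X]mulrN1.
apply: (@is_derive1_comp _ (flat 1) (fun x => - 1 * x + 1)).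
  exact: is_derive_flat.
by apply: is_derive_eq; rewrite /GRing.scale/=; ring.
Qed.

Lemma bump_bounded :
  exists2 K : R, 0 < K & forall x, `|bump01 x| <= K /\ `|derive1 bump01 x| <= K.
Proof.
have bd f : elementary f -> (forall x, x <= 0 \/ 1 <= x -> f x = 0) ->
    exists2 K : R, 0 < K & forall x, `|f x| <= K.
  move=> ef fout.
  have [|c _ cmax] := @EVT_max R (fun x => `|f x|) 0 1 ler01.
    apply: continuous_subspaceT => x.
    by apply: cvg_norm; exact: elementary_continuous.
  exists (`|f c| + 1) => [|x]; first by rewrite ltr_wpDl.
  have [x0|x0] := leP x 0; first by rewrite fout ?normr0 ?addr_ge0//; left.
  have [x1|x1] := leP 1 x; first by rewrite fout ?normr0 ?addr_ge0//; right.
  by rewrite ler_wpDr// cmax// in_itv/= !ltW.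
have [K K0 hK] := bd _ elementary_bump bump_out.
have [L L0 hL] := bd _ (elementary_derive1 elementary_bump) dbump_out.
exists (K + L) => [|x]; first by rewrite addr_gt0.
by have [h1 h2] := (hK x, hL x); split; lra.
Qed.

End Elementary.

(** * Smoothness on the quadrant *)

Section Quadrant.
Context {R : realType}.
Implicit Types (f g : R -> R) (x t : R).

(** Slopes at a point of the half-line only see the values taken there, so a
    function may be replaced by a differentiable function on the whole line. *)
Lemma cvg_slopes f g x l : 0 <= x -> {in @halfline R, f =1 g} ->
  is_derive x 1 g l -> slopes f x --> l.
Proof.
move=> x0 fg g'.
have cv : h^-1 *: ((g \o shift x) (h *: 1) - g x) @[h --> 0^'] --> l.
  by rewrite -(@derive_val _ _ _ _ _ _ _ g'); exact: ex_derive.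
apply/cvgrPdist_le => e e0; have /cvgrPdist_le /(_ e e0) := cv.
rewrite /prop_near1 /nbhs/= /dnbhs /within/= => /nbhs_ballP[d /= d0 de].
apply/nbhs_ballP; exists d => //= y xy yx y0.
have yx0 : y - x != 0 by rewrite subr_eq0.
have := de (y - x); rewrite /ball/= sub0r normrN distrC => /(_ xy yx0).
rewrite /GRing.scale/= mulr1 subrK mulrC !fg ?inE//.
by rewrite /halfline/= in_itv/= x0.
Qed.

(** Every point of the half-line is a limit of other points of it, which makes
    limits of slopes unique. *)
Lemma slopes_proper x : 0 <= x -> ProperFilter (within (@halfline R) x^').
Proof.
move=> x0; apply: Build_ProperFilter_ex => P /nbhs_ballP[d /= d0 dP].
exists (x + d / 2); apply: dP.
- by rewrite /ball/= opprD addNKr normrN gtr0_norm; lra.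
- by rewrite /= -subr_eq0; apply/eqP; lra.
- by rewrite /halfline/= in_itv/= andbT; lra.
Qed.

Lemma hderive_is_derive f g x l : 0 <= x -> {in @halfline R, f =1 g} ->
  is_derive x 1 g l -> hderivable f x /\ hderive f x = l.
Proof.
move=> x0 fg g'; have pf := slopes_proper x0; have fl := cvg_slopes x0 fg g'.
by split; [apply/cvg_ex; exists l|exact/cvg_lim].
Qed.

(** The two variables are kept separated, so that each partial derivative acts on
    one family of factors. *)
Definition tensor N (g k : 'I_N -> R -> R) (p : R * R) : R :=
  \sum_(i < N) g i p.1 * k i p.2.

Lemma is_derive_sum_fun N (F : 'I_N -> R -> R) (dF : 'I_N -> R) x :
  (forall i, is_derive x 1 (F i) (dF i)) ->
  is_derive x 1 (fun y => \sum_(i < N) F i y) (\sum_(i < N) dF i).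
Proof.
move=> F'; have := is_derive_sum F'.
by congr is_derive; apply/funext => y; rewrite fct_sumE.
Qed.

Lemma is_derive_tensorx N (g k : 'I_N -> R -> R) x t :
  (forall i, elementary (g i)) ->
  is_derive x 1 (fun y => tensor g k (y, t))
    (tensor (fun i => derive1 (g i)) k (x, t)).
Proof.
move=> eg; apply: is_derive_sum_fun => i /=; have := elementary_is_derive x (eg i).
move=> g'; rewrite mulrC; have -> : (fun y => g i y * k i t) = (k i t) \*: g i.
  by apply/funext => y; rewrite /= mulrC.
exact: is_deriveZ.
Qed.

Lemma is_derive_tensort N (g k : 'I_N -> R -> R) x t :
  (forall i, elementary (k i)) ->
  is_derive t 1 (fun s => tensor g k (x, s))
    (tensor g (fun i => derive1 (k i)) (x, t)).
Proof.
move=> ek; apply: is_derive_sum_fun => i /=; have := elementary_is_derive t (ek i).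
by move=> k'; exact: is_deriveZ.
Qed.

Lemma tensor_continuous N (g k : 'I_N -> R -> R) :
  (forall i, elementary (g i)) -> (forall i, elementary (k i)) ->
  continuous (tensor g k).
Proof.
move=> eg ek p; apply: cvg_big => [|i _]; first exact: add_continuous.
apply: cvgM.
  by apply: (@continuous_comp _ _ _ fst); [exact: cvg_fst|exact: elementary_continuous].
by apply: (@continuous_comp _ _ _ snd); [exact: cvg_snd|exact: elementary_continuous].
Qed.

Lemma tensor_hderive N (g k : 'I_N -> R -> R) (F : R * R -> R) :
  (forall i, elementary (g i)) -> (forall i, elementary (k i)) ->
  (forall p, quadrant p -> F p = tensor g k p) ->
  forall p, quadrant p ->
  [/\ x_derivable F p, t_derivable F p,
      dx F p = tensor (fun i => derive1 (g i)) k p &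
      dt F p = tensor g (fun i => derive1 (k i)) p].
Proof.
move=> eg ek FE [x t] [/= x0 t0].
have xE : {in @halfline R, (fun y => F (y, t)) =1 (fun y => tensor g k (y, t))}.
  by move=> y /set_mem y0; exact: FE.
have tE : {in @halfline R, (fun s => F (x, s)) =1 (fun s => tensor g k (x, s))}.
  by move=> s /set_mem s0; exact: FE.
move: x0 t0; rewrite /halfline/= !in_itv/= !andbT => x0 t0.
have [? ?] := hderive_is_derive x0 xE (is_derive_tensorx k x t eg).
by have [? ?] := hderive_is_derive t0 tE (is_derive_tensort g x t ek).
Qed.

(** The partial derivatives of a tensor are tensors, hence an induction over all
    tensors together. The equality is only asked on the quadrant because [dx F] and
    [dt F] are uncontrolled outside it. *)
Lemma tensor_C_quadrant n N (g k : 'I_N -> R -> R) (F : R * R -> R) :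
  (forall i, elementary (g i)) -> (forall i, elementary (k i)) ->
  (forall p, quadrant p -> F p = tensor g k p) -> C_quadrant n F.
Proof.
elim: n g k F => [|n IH] g k F eg ek FE.
all: have Fcont : {within @quadrant R, continuous F} by
  apply: (@subspace_eq_continuous _ _ _ (tensor g k));
  [move=> p /set_mem pq; rewrite -FE|
   apply: continuous_subspaceT; exact: tensor_continuous].
all: split=> //; have dF := tensor_hderive eg ek FE.
split.
- by move=> p /dF[].
- by move=> p /dF[].
- apply: (IH (fun i => derive1 (g i)) k) => // [i|p /dF[]//].
  exact: elementary_derive1.
- apply: (IH g (fun i => derive1 (k i))) => // [i|p /dF[]//].
  exact: elementary_derive1.
Qed.

End Quadrant.

(** * Integrals for the completed Lebesgue measure *)

Section Integration.
Context {R : realType}.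
Implicit Types (f g : R -> R) (x : R).
Notation mu := (@completed_lebesgue_measure R).
Notation leb := (@lebesgue_measure R).

Lemma measurable_LebesgueR (D : set R) :
  measurable D -> measurable (D : set (LebesgueR R)).
Proof. by move=> mD; apply: sub_caratheodory. Qed.

Lemma measurable_fun_id_LebesgueR :
  measurable_fun setT (idfun : LebesgueR R -> measurableTypeR R).
Proof. by move=> _ D mD; rewrite setTI; exact: measurable_LebesgueR. Qed.

Lemma continuous_lebesgue_measurable (D : set R) f :
  continuous f -> lebesgue_measurable_fun D f.
Proof.
move=> cf; apply: measurable_funTS.
apply: (@measurableT_comp _ _ _ _ _ _ f _ (idfun : LebesgueR R -> measurableTypeR R)).
  exact: continuous_measurable_fun.
exact: measurable_fun_id_LebesgueR.
Qed.

Lemma completed_lebesgue_itv (a b : R) : a <= b ->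
  mu [set` `[a, b[] = (b - a)%:E.
Proof.
move=> ab; have := @lebesgue_measure_itv R `[a, b[; rewrite /= lte_fin => H.
apply: eq_trans H _; case: ltP => // ba.
by rewrite (@le_anti _ _ a b) ?ab// subrr.
Qed.

Lemma bounded_itv_integrable (a b M : R) f :
  lebesgue_measurable_fun [set` `[a, b[] f -> (forall x, a <= x < b -> `|f x| <= M) ->
  mu.-integrable [set` `[a, b[] (EFin \o f).
Proof.
move=> mf bf; apply: measurable_bounded_integrable => //.
- exact: measurable_LebesgueR.
- have [ab|ba] := leP a b; last first.
    by rewrite set_itv_ge ?measure0// bnd_simp ltNge ltW.
  rewrite -[X in (X < _)%E]/(mu [set` `[a, b[]).
  by rewrite (completed_lebesgue_itv ab) ltry.
- exists M; split; first exact: num_real.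
  move=> N MN x /=; rewrite in_itv/= => /bf fx; exact: le_trans fx (ltW MN).
Qed.

Lemma continuous_itv_bounded (a b : R) f : continuous f ->
  exists M, forall x, a <= x <= b -> `|f x| <= M.
Proof.
move=> cf; have [ab|ba] := leP a b; last by exists 0 => x; lra.
have [|c _ cmax] := @EVT_max R (fun x => `|f x|) a b ab.
  by apply: continuous_subspaceT => x; apply: cvg_norm; exact: cf.
by exists `|f c| => x xab; apply: cmax; rewrite in_itv.
Qed.

Lemma continuous_itv_integrable (a b : R) f : continuous f ->
  mu.-integrable [set` `[a, b[] (EFin \o f).
Proof.
move=> cf; have [M fM] := continuous_itv_bounded a b cf.
apply: (@bounded_itv_integrable _ _ M).
  exact: continuous_lebesgue_measurable.
by move=> x /andP[ax xb]; apply: fM; rewrite ax ltW.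
Qed.

(** The Lebesgue measure is the image of its completion under the identity, so the
    two measures give the same integral to a Borel function. *)
Lemma completed_integral f (a b : R) : continuous f ->
  \int[mu]_(x in `[a, b[) f x = fine (\int[leb]_(x in `[a, b]) (f x)%:E)%E.
Proof.
move=> cf; rewrite /Rintegral; congr fine.
have mf : measurable_fun setT (EFin \o f : measurableTypeR R -> \bar R).
  by apply/measurable_EFinP; exact: continuous_measurable_fun.
rewrite -integral_itv_bndo_bndc; last exact: measurable_funTS.
have := @integral_pushforward _ _ _ _ _ _ measurable_fun_id_LebesgueR mu `[a, b[ _ mf.
by move=> /(_ (continuous_itv_integrable _ _ cf)) H; rewrite H.
Qed.

Lemma completed_FTC f F (a b : R) : a <= b -> continuous f ->
  (forall x, a <= x <= b -> is_derive x 1 F (f x)) ->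
  \int[mu]_(x in `[a, b[) f x = F b - F a.
Proof.
rewrite le_eqVlt => /predU1P[->|ab] cf F'.
  by rewrite set_itv_ge ?Rintegral_set0 ?subrr// bnd_simp ltxx.
have dF x : a <= x <= b -> derivable F x 1 by move=> /F' /@ex_derive.
have cF x : a <= x <= b -> {for x, continuous F}.
  by move=> /dF Fx; apply/differentiable_continuous/derivable1_diffP.
rewrite completed_integral// (@continuous_FTC2 _ f F)//.
- by apply: continuous_subspaceT.
- split.
  + by move=> x; rewrite in_itv/= => /andP[? ?]; apply: dF; rewrite !ltW.
  + by apply: cvg_at_right_filter; apply: cF; rewrite lexx ltW.
  + by apply: cvg_at_left_filter; apply: cF; rewrite lexx ltW.
- move=> x; rewrite in_itv/= => /andP[ax xb]; rewrite derive1E.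
  by apply: derive_val; apply: F'; rewrite !ltW.
Qed.

End Integration.

(** * Cells *)

Section Cells.
Context {R : realType}.
Implicit Types (f g : R -> R) (x h : R).
Notation mu := (@completed_lebesgue_measure R).

Definition cell h (k : nat) : set R := [set` `[k%:R * h, k.+1%:R * h[].

Definition unit_integral f : R := \int[mu]_(x in [set` `[0, 1[]) f x.

Lemma continuous_primitive f : continuous f ->
  exists F : R -> R, forall x, 0 <= x <= 1 -> is_derive x 1 F (f x).
Proof.
move=> cf; exists (fun x => \int[@lebesgue_measure R]_(t in `[-1, x]) f t).
move=> x /andP[x0 x1].
have fi : (@lebesgue_measure R).-integrable `[-1, 2] (EFin \o f).
  apply: continuous_compact_integrable; first exact: segment_compact.
  exact: continuous_subspaceT.
have x2 : x < 2 by lra.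
have mx : -1 < x by lra.
have [dF F'] := continuous_FTC1_closed x2 fi mx (cf x).
by apply: DeriveDef => //; rewrite -derive1E F'.
Qed.

Lemma unit_integral_derive f F : continuous f ->
  (forall x, is_derive x 1 F (f x)) -> unit_integral f = F 1 - F 0.
Proof. by move=> cf F'; apply: completed_FTC. Qed.

Lemma unit_integralD f g : continuous f -> continuous g ->
  unit_integral (fun x => f x + g x) = unit_integral f + unit_integral g.
Proof.
move=> cf cg; rewrite /unit_integral RintegralD//.
- exact: measurable_LebesgueR.
- exact: continuous_itv_integrable.
- exact: continuous_itv_integrable.
Qed.

Lemma unit_integralZ f a : continuous f ->
  unit_integral (fun x => a * f x) = a * unit_integral f.
Proof.
move=> cf; rewrite /unit_integral RintegralZl//.
- exact: measurable_LebesgueR.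
- exact: continuous_itv_integrable.
Qed.

(** A primitive of [f] is nondecreasing; if its values at 0 and 1 were equal it
    would be constant, and its derivative could not be positive at [y]. *)
Lemma unit_integral_gt0 f y : continuous f -> (forall x, 0 <= f x) ->
  0 < y < 1 -> 0 < f y -> 0 < unit_integral f.
Proof.
move=> cf f0 /andP[y0 y1] fy; have [F F'] := continuous_primitive cf.
rewrite /unit_integral (@completed_FTC _ f F)//.
have le01 a b : 0 <= a -> b <= 1 -> a <= b -> F a <= F b.
  move=> a0 b1 ab.
  have [x|c|c] := @MVT_segment _ F f a b ab.
  - by rewrite in_itv/= => /andP[? ?]; apply: F'; lra.
  - apply: derivable_within_continuous => z; rewrite in_itv/= => /andP[? ?].
    have zz : 0 <= z <= 1 by lra.
    by have := F' z zz; move=> /@ex_derive.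
  - move=> _ Fab; rewrite -subr_ge0 Fab mulr_ge0// subr_ge0//.
have yy : 0 <= y <= 1 by lra.
rewrite subr_gt0 lt_neqAle (le01 0 1)// andbT; apply/negP => /eqP F01.
have cst z : 0 <= z <= 1 -> F z = F 0.
  move=> /andP[z0 z1]; apply/eqP; rewrite eq_le.
  by apply/andP; split; [rewrite F01|]; exact: le01.
have : is_derive y 1 F 0.
  apply: (@near_eq_is_derive _ _ _ (fun=> F 0)).
  near=> z; rewrite cst//; apply/andP; split; apply/ltW.
    by near: z; exact: lt_nbhsr.
  by near: z; exact: lt_nbhsl.
move=> /@derive_val; have := F' y yy => /@derive_val -> f0y.
by rewrite f0y ltxx in fy.
Unshelve. all: by end_near. Qed.

(** The change of variables is read off from a primitive of [f]. *)
Lemma integral_cell_scale f h k : 0 < h -> continuous f ->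
  \int[mu]_(x in cell h k) f (x / h - k%:R) = h * unit_integral f.
Proof.
move=> h0 cf; have [F F'] := continuous_primitive cf.
rewrite /unit_integral (@completed_FTC _ f F)//.
transitivity (h * F (k.+1%:R * h / h - k%:R) - h * F (k%:R * h / h - k%:R));
  last first.
  by rewrite !mulfK ?gt_eqF// subrr -natr1 addrAC subrr add0r mulrBr.
apply: (@completed_FTC _ _ (fun x => h * F (x / h - k%:R))).
- by rewrite ler_pM2r// ler_nat.
- move=> x; apply: (@continuous_comp _ _ _ (fun x => x / h - k%:R) f); last exact: cf.
  apply: differentiable_continuous; apply/derivable1_diffP.
  exact: ex_derive.
- move=> x /andP[xk xk1].
  have z : 0 <= x / h - k%:R <= 1.
    by rewrite subr_ge0 ler_pdivlMr// xk/= lerBlDl natr1 ler_pdivrMr.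
  have g' : is_derive x 1 (fun x => x / h - k%:R) h^-1.
    by apply: is_derive_eq; rewrite /GRing.scale/=; ring.
  have := @is_derive1_comp _ F (fun x => x / h - k%:R) x _ _ (F' _ z) g'.
  move=> Fg'; have := is_deriveZ h Fg'; rewrite /GRing.scale/=.
  by rewrite mulrC divfK// gt_eqF.
Qed.

End Cells.

(** * Pairing with functions of mean zero on every cell *)

Section Pairing.
Context {R : realType}.
Implicit Types (f g phi : R -> R) (x h : R).
Notation mu := (@completed_lebesgue_measure R).

Lemma normr_itv_integral_le f (a b M : R) : a <= b ->
  lebesgue_measurable_fun [set` `[a, b[] f ->
  (forall x, a <= x < b -> `|f x| <= M) ->
  `|\int[mu]_(x in [set` `[a, b[]) f x| <= M * (b - a).
Proof.
move=> ab mf fM.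
have mD : measurable ([set` `[a, b[] : set (LebesgueR R)).
  exact: measurable_LebesgueR.
have fi : mu.-integrable [set` `[a, b[] (EFin \o f).
  exact: bounded_itv_integrable mf fM.
apply: le_trans (le_normr_Rintegral mD fi) _.
have -> : M * (b - a) = \int[mu]_(x in [set` `[a, b[]) (cst M x).
  by rewrite Rintegral_cst//; have -> := congr1 fine (completed_lebesgue_itv ab).
apply: le_Rintegral => //.
- exact: integrable_norm.
- by apply: continuous_itv_integrable; exact: cst_continuous.
Qed.

Lemma lebesgue_measurable_itv f (a b : R) : 0 <= a ->
  lebesgue_measurable_fun (@halfline R) f ->
  lebesgue_measurable_fun [set` `[a, b[] f.
Proof.
move=> a0 mf; apply: (measurable_funS _ _ mf).
  by apply: measurable_LebesgueR; exact: measurable_itv.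
by move=> x; rewrite /halfline/= !in_itv/= andbT => /andP[ax _]; exact: le_trans ax.
Qed.

Lemma lebesgue_measurableM (D : set R) f g :
  lebesgue_measurable_fun D f -> lebesgue_measurable_fun D g ->
  lebesgue_measurable_fun D (fun x => f x * g x).
Proof. by move=> mf mg; apply: measurable_funM. Qed.

Lemma lebesgue_measurableB (D : set R) f g :
  lebesgue_measurable_fun D f -> lebesgue_measurable_fun D g ->
  lebesgue_measurable_fun D (fun x => f x - g x).
Proof. by move=> mf mg; apply: measurable_funB. Qed.

Lemma hintegral_itv f (b : R) : (forall x, b <= x -> f x = 0) ->
  hintegral f = \int[mu]_(x in [set` `[0, b[]) f x.
Proof.
move=> f0; rewrite /hintegral Rintegral_mkcond [RHS]Rintegral_mkcond.
congr Rintegral; apply/funext => x; rewrite /patch !mem_setE /halfline.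
rewrite !in_itv/= andbT; have [x0|//] := boolP (0 <= x).
by case: ltP => // bx; rewrite f0.
Qed.

(** On the k-th cell [phi] may be replaced by [phi - phi (k h)], which is at most
    [L * h], because [g] has mean zero there. *)
Lemma pairing_le h (n : nat) g phi (M L : R) : 0 < h -> 0 <= M -> 0 <= L ->
  lebesgue_measurable_fun (@halfline R) g ->
  (forall x, 0 <= x -> `|g x| <= M) ->
  (forall k, (k < n)%N -> \int[mu]_(x in cell h k) g x = 0) ->
  continuous phi ->
  (forall x y, `|phi x - phi y| <= L * `|x - y|) ->
  (forall x, n%:R * h <= x -> phi x = 0) ->
  `|hintegral (fun x => g x * phi x)| <= M * L * h * (n%:R * h).
Proof.
move=> h0 M0 L0 mg gM g0 cphi Lphi phi0.
rewrite (@hintegral_itv _ (n%:R * h)); last by move=> x nx; rewrite phi0// mulr0.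
have mgphi : lebesgue_measurable_fun (@halfline R) (fun x => g x * phi x).
  by apply: lebesgue_measurableM => //; exact: continuous_lebesgue_measurable.
have gphi_int a b : 0 <= a ->
    mu.-integrable [set` `[a, b[] (EFin \o (fun x => g x * phi x)).
  move=> a0; have [N phiN] := continuous_itv_bounded a b cphi.
  apply: (@bounded_itv_integrable _ _ _ (M * N)).
    exact: lebesgue_measurable_itv.
  move=> x /andP[ax xb]; rewrite normrM ler_pM//.
    by rewrite gM// (le_trans a0).
  by rewrite phiN// ax ltW.
have kh k : 0 <= k%:R * h by rewrite mulr_ge0// ltW.
suff : forall m, (m <= n)%N ->
    `|\int[mu]_(x in [set` `[0, m%:R * h[]) (g x * phi x)| <= M * L * h * (m%:R * h).
  exact.
elim=> [_|m IH mn].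
  by rewrite mul0r set_itv_ge ?bnd_simp ?ltxx// Rintegral_set0 normr0 mulr0.
have mm : m%:R * h <= m.+1%:R * h by rewrite ler_pM2r// ler_nat.
have -> : [set` `[0, m.+1%:R * h[] = [set` `[0, m%:R * h[] `|` cell h m.
  by rewrite /cell -itv_bndbnd_setU// bnd_simp.
rewrite Rintegral_setU//=; first last.
- apply/disj_setPS => x /= []; rewrite /cell/= !in_itv/= => /andP[_ xm] /andP[mx _].
  by have := le_lt_trans mx xm; rewrite ltxx.
- rewrite /cell -itv_bndbnd_setU//; [exact: gphi_int|by rewrite bnd_simp..].
- by apply: measurable_LebesgueR; exact: measurable_itv.
- by apply: measurable_LebesgueR; exact: measurable_itv.
apply: le_trans (ler_normD _ _) _.
rewrite -natr1 mulrDl mul1r mulrDr lerD// ?IH 1?ltnW//.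
have mmg := @lebesgue_measurable_itv g (m%:R * h) (m.+1%:R * h) (kh m) mg.
have gint : mu.-integrable (cell h m) (EFin \o g).
  apply: (@bounded_itv_integrable _ _ _ M) => // x /andP[mx _].
  by rewrite gM// (le_trans _ mx).
have -> : \int[mu]_(x in cell h m) (g x * phi x) =
    \int[mu]_(x in cell h m) (g x * phi x - g x * phi (m%:R * h)).
  rewrite RintegralB//.
  - rewrite RintegralZr// ?g0// ?mul0r ?subr0//.
    by apply: measurable_LebesgueR; exact: measurable_itv.
  - by apply: measurable_LebesgueR; exact: measurable_itv.
  - exact: gphi_int.
  - have := integrableZr (measurable_LebesgueR
      (measurable_itv `[m%:R * h, m.+1%:R * h[)) (phi (m%:R * h)) gint.
    by [].
apply: le_trans (@normr_itv_integral_le _ _ _ (M * (L * h)) mm _ _) _.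
- apply: lebesgue_measurableB.
    exact: lebesgue_measurable_itv.
  apply: lebesgue_measurableM => //.
  by apply: continuous_lebesgue_measurable; exact: cst_continuous.
- move=> x /andP[mx xm]; rewrite -mulrBr normrM ler_pM//.
    by rewrite gM// (le_trans _ mx).
  apply: le_trans (Lphi _ _) _; rewrite ler_wpM2l// ger0_norm ?subr_ge0//.
  by move: xm; rewrite -natr1 mulrDl mul1r; lra.
- by rewrite -natr1 mulrDl mul1r addrAC subrr add0r !mulrA.
Qed.

End Pairing.

(** * Test functions *)

Section TestFunctions.
Context {R : realType}.
Implicit Types (f g G phi : R -> R) (x h : R).
Notation mu := (@completed_lebesgue_measure R).

Lemma derivable_continuous f : (forall x, derivable f x 1) -> continuous f.
Proof. by move=> df x; apply/differentiable_continuous/derivable1_diffP. Qed.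

Lemma derivable_is_derive1 f x : derivable f x 1 -> is_derive x 1 f (derive1 f x).
Proof. by move=> df; rewrite derive1E; exact: DeriveDef. Qed.

Lemma lipschitz_of_derive f (L : R) : (forall x, derivable f x 1) ->
  (forall x, `|derive1 f x| <= L) ->
  forall x y, `|f x - f y| <= L * `|x - y|.
Proof.
move=> df fL x y; wlog xy : x y / x <= y => [H|].
  have [/H//|/ltW/H] := leP x y.
  by rewrite distrC (distrC y).
have f' z (_ : z \in `]x, y[) := derivable_is_derive1 (df z).
have [|c _] := MVT_segment xy f'.
  exact/continuous_subspaceT/derivable_continuous.
by rewrite distrC => ->; rewrite normrM (distrC x) ler_wpM2r.
Qed.

Definition vanishes_off f (a b : R) := forall x, x < a \/ b < x -> f x = 0.

Lemma vanishes_off_derive f (a b : R) :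
  vanishes_off f a b -> vanishes_off (derive1 f) a b.
Proof.
move=> f0 x xab; rewrite derive1E (@near_eq_derive _ _ _ _ (cst 0)) ?derive_cst//.
case: xab => [xa|bx].
  by near=> y; apply: f0; left; near: y; exact: lt_nbhsl.
by near=> y; apply: f0; right; near: y; exact: lt_nbhsr.
Unshelve. all: by end_near. Qed.

(** A closed set that misses 0 keeps a positive distance from it. *)
Lemma test_function_vanishes phi : test_function phi ->
  exists a b : R, [/\ 0 < a, a < b & vanishes_off phi a b].
Proof.
move=> [_ cS S0]; set S := closure _ in cS S0.
have [M [_ /(_ (`|M| + 1)) SM]] := compact_bounded cS.
have nS0 : ~ S 0 by move=> /S0/=; rewrite in_itv/= ltxx.
have /nbhs_ballP[a /= a0 aS] : nbhs 0 (~` S).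
  by apply: open_nbhs_nbhs; split=> //; apply/closed_openC/closed_closure.
exists a, (a + `|M| + 1); split=> //.
  by have := normr_ge0 M; lra.
move=> x xab; apply: contrapT => /eqP fx.
have Sx : S x by exact: subset_closure.
have /= := S0 _ Sx; rewrite in_itv/= andbT => x0.
case: xab => [xa|bx].
  by apply: (aS x) => //; rewrite /ball/= sub0r normrN gtr0_norm.
have MM : M < `|M| + 1 by rewrite (le_lt_trans (ler_norm _))// ltrDl.
have := SM MM x Sx; rewrite /= (gtr0_norm x0) => xM; lra.
Qed.

Lemma bounded_of_vanishes f (a b : R) : continuous f -> vanishes_off f a b ->
  exists2 L : R, 0 <= L & forall x, `|f x| <= L.
Proof.
move=> cf f0; have [M fM] := continuous_itv_bounded a b cf.
exists `|M| => // x; have [xa|ax] := ltP x a; first by rewrite f0 ?normr0//; left.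
have [bx|xb] := ltP b x; first by rewrite f0 ?normr0//; right.
by apply: le_trans (ler_norm _); rewrite fM// ax.
Qed.

Lemma test_function_lipschitz phi : test_function phi ->
  exists a b L : R, [/\ 0 < a < b, 0 <= L,
    vanishes_off phi a b /\ vanishes_off (derive1 phi) a b,
    forall x y, `|phi x - phi y| <= L * `|x - y| &
    forall x y, `|derive1 phi x - derive1 phi y| <= L * `|x - y|].
Proof.
move=> tphi; have [a [b [a0 ab phi0]]] := test_function_vanishes tphi.
have [dphi _ _] := tphi.
have phi'0 := vanishes_off_derive phi0; have phi''0 := vanishes_off_derive phi'0.
have [L1 L10 hL1] := bounded_of_vanishes (derivable_continuous (dphi 1%N)) phi'0.
have [L2 L20 hL2] := bounded_of_vanishes (derivable_continuous (dphi 2%N)) phi''0.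
exists a, b, (L1 + L2); split=> //; [by rewrite a0|exact: addr_ge0| |].
- apply: lipschitz_of_derive => [x|x]; first exact: (dphi 0%N).
  by apply: le_trans (hL1 x) _; rewrite lerDl.
- apply: lipschitz_of_derive => [x|x]; first exact: (dphi 1%N).
  by apply: le_trans (hL2 x) _; rewrite lerDr.
Qed.

(** There is no boundary term: [phi] vanishes near 0 and far away. *)
Lemma integration_by_parts_test G phi : elementary G -> test_function phi ->
  hintegral (fun x => derive1 G x * phi x) =
  - hintegral (fun x => G x * derive1 phi x).
Proof.
move=> eG tphi; have [a [b [a0 ab phi0]]] := test_function_vanishes tphi.
have [dphi _ _] := tphi; have phi'0 := vanishes_off_derive phi0.
have cphi := derivable_continuous (dphi 0%N).
have cphi' := derivable_continuous (dphi 1%N).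
have cG := elementary_continuous eG.
have cG' := elementary_continuous (elementary_derive1 eG).
have b1 x : b + 1 <= x -> b < x by lra.
rewrite !(@hintegral_itv _ _ (b + 1)); first last.
- by move=> x /b1 bx; rewrite phi0 ?mulr0//; right.
- by move=> x /b1 bx; rewrite phi'0 ?mulr0//; right.
have c1 : continuous (fun x => derive1 G x * phi x).
  by move=> x; apply: cvgM; [exact: cG'|exact: cphi].
have c2 : continuous (fun x => G x * derive1 phi x).
  by move=> x; apply: cvgM; [exact: cG|exact: cphi'].
apply/eqP; rewrite -addr_eq0 -RintegralD//; first last.
- exact: continuous_itv_integrable.
- exact: continuous_itv_integrable.
- exact: measurable_LebesgueR.
apply/eqP; transitivity (G (b + 1) * phi (b + 1) - G 0 * phi 0).
  apply: (@completed_FTC _ _ (fun x => G x * phi x)); first lra.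
    by move=> x; apply: cvgD; [exact: c1|exact: c2].
  move=> x _; have G' := elementary_is_derive x eG.
  have phi' := derivable_is_derive1 (dphi 0%N x).
  apply: is_derive_eq; rewrite /GRing.scale/=; ring.
by rewrite !phi0 ?mulr0 ?subrr//; [left|right; lra].
Qed.

End TestFunctions.

(** * Trains of bumps *)

Section BumpTrain.
Context {R : realType}.
Implicit Types (a b d e : nat -> R) (x y h : R).
Notation mu := (@completed_lebesgue_measure R).
Notation dbump := (derive1 (@bump01 R)).

(** The derivative of the bump serves as an oscillating profile: it has integral
    zero and is orthogonal to the bump, so that the coefficients [d] change the
    means of products of trains without changing the means of the trains. *)
Definition bump_train h n a d x : R :=
  \sum_(k < n) (a k * bump01 (x / h - k%:R) + d k * dbump (x / h - k%:R)).

Lemma elementary_rescale f h (k : R) :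
  elementary f -> elementary (fun x => f (x / h - k)).
Proof.
move=> ef; rewrite (_ : (fun _ => _) = fun x => f (h^-1 * x + - k)).
  exact: elementary_affine.
by apply/funext => x; rewrite mulrC.
Qed.

Lemma elementary_bump_train h n a d : elementary (bump_train h n a d).
Proof.
apply: elementary_sum => k; apply: elementaryD; apply: elementaryM.
- exact: elementary_cst.
- exact/elementary_rescale/elementary_bump.
- exact: elementary_cst.
- exact/elementary_rescale/elementary_derive1/elementary_bump.
Qed.

Lemma cellP h k x : 0 < h -> cell h k x <-> 0 <= x / h - k%:R < 1.
Proof.
move=> h0; rewrite /cell/= in_itv/= subr_ge0.
by rewrite ler_pdivlMr// ltrBlDl natr1 ltr_pdivrMr.
Qed.

Lemma bump_train_cell h n a d k x : 0 < h -> (k < n)%N -> cell h k x ->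
  bump_train h n a d x =
  a k * bump01 (x / h - k%:R) + d k * dbump (x / h - k%:R).
Proof.
move=> h0 kn /(cellP _ _ h0) /andP[xk xk1].
rewrite /bump_train (bigD1 (Ordinal kn))//= big1 ?addr0// => j jk.
have out : x / h - j%:R <= 0 \/ 1 <= x / h - j%:R.
  have [jk'|kj|E] := ltngtP j k; last by move: jk; rewrite -val_eqE/= E eqxx.
  - right; have : j.+1%:R <= k%:R :> R by rewrite ler_nat.
    by rewrite -natr1; lra.
  - left; have : k.+1%:R <= j%:R :> R by rewrite ler_nat.
    by rewrite -natr1; lra.
by rewrite bump_out// dbump_out// !mulr0 addr0.
Qed.

Lemma bump_train_le0 h n a d x : 0 < h -> x <= 0 -> bump_train h n a d x = 0.
Proof.
move=> h0 x0; rewrite /bump_train big1// => k _.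
have out : x / h - k%:R <= 0 \/ 1 <= x / h - k%:R.
  left; rewrite subr_le0 (@le_trans _ _ 0)//.
  by rewrite ler_pdivrMr// mul0r.
by rewrite bump_out// dbump_out// !mulr0 addr0.
Qed.

Lemma bump_train_ge h n a d x : 0 < h -> n%:R * h <= x -> bump_train h n a d x = 0.
Proof.
move=> h0; rewrite -ler_pdivlMr// => nx; rewrite /bump_train big1// => k _.
have out : x / h - k%:R <= 0 \/ 1 <= x / h - k%:R.
  right; have : k.+1%:R <= n%:R :> R by rewrite ler_nat.
  by rewrite -natr1; lra.
by rewrite bump_out// dbump_out// !mulr0 addr0.
Qed.

(** At each point at most one term is nonzero, so the bound depends neither on the
    number of cells nor on their width. *)
Lemma bump_train_bounded (A B : R) : 0 <= A -> 0 <= B ->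
  exists2 K : R, 0 < K & forall h n a d, 0 < h ->
    (forall k, (k < n)%N -> `|a k| <= A) ->
    (forall k, (k < n)%N -> `|d k| <= B) ->
    forall x, `|bump_train h n a d x| <= K.
Proof.
move=> A0 B0; have [K K0 hK] := @bump_bounded R.
have AB : 0 <= A * K + B * K by rewrite addr_ge0// mulr_ge0// ltW.
exists (A * K + B * K + 1) => [|h n a d h0 aA dB x]; first by rewrite ltr_wpDl.
have [x0|x0] := leP x 0; first by rewrite bump_train_le0// normr0 addr_ge0.
have [nx|xn] := leP (n%:R * h) x; first by rewrite bump_train_ge// normr0 addr_ge0.
have xh : 0 <= x / h by rewrite divr_ge0// ltW.
set k := Num.truncn (x / h).
have /andP[kx xk] := truncn_itv xh.
have kn : (k < n)%N.
  by rewrite -(ltr_nat R) (le_lt_trans kx)// ltr_pdivrMr.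
rewrite (bump_train_cell _ _ h0 kn); last first.
  by apply/cellP => //; rewrite subr_ge0 kx ltrBlDl natr1.
have [h1 h2] := hK (x / h - k%:R).
rewrite (@le_trans _ _ (A * K + B * K))// ?lerDl//.
apply: le_trans (ler_normD _ _) _; rewrite (normrM (a k)) (normrM (d k)).
by rewrite lerD// ler_pM// ?aA ?dB.
Qed.

Definition mass : R := unit_integral (@bump01 R).
Definition energy : R := unit_integral (fun y : R => bump01 y * bump01 y).
Definition denergy : R := unit_integral (fun y => dbump y * dbump y).

Let cbump : continuous (@bump01 R).
Proof. exact/elementary_continuous/elementary_bump. Qed.

Let cdbump : continuous dbump.
Proof. exact/elementary_continuous/elementary_derive1/elementary_bump. Qed.

Let cmul (f g : R -> R) : continuous f -> continuous g ->
  continuous (fun y => f y * g y).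
Proof. by move=> cf cg y; apply: cvgM; [exact: cf|exact: cg]. Qed.

Let cadd (f g : R -> R) : continuous f -> continuous g ->
  continuous (fun y => f y + g y).
Proof. by move=> cf cg y; apply: cvgD; [exact: cf|exact: cg]. Qed.

Let cscale (c : R) (f : R -> R) : continuous f -> continuous (fun y => c * f y).
Proof. by move=> cf y; apply: cvgM; [exact: cvg_cst|exact: cf]. Qed.

Lemma mass_gt0 : 0 < mass.
Proof.
apply: (@unit_integral_gt0 _ _ 2^-1) => //; first exact: bump_ge0.
- by rewrite invr_gt0 ltr0n/= invf_lt1// ltr1n.
- exact: bump_half.
Qed.

Lemma energy_ge0 : 0 <= energy.
Proof. by apply: Rintegral_ge0 => y _; rewrite -expr2 sqr_ge0. Qed.

(** The bump takes different values at 0 and 1/2, so its derivative is nonzero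
    somewhere in between. *)
Lemma denergy_gt0 : 0 < denergy.
Proof.
have b' y : is_derive y 1 (@bump01 R) (dbump y).
  exact/elementary_is_derive/elementary_bump.
have half0 : 0 < 2^-1 :> R by rewrite invr_gt0.
have half1 : 2^-1 < 1 :> R by rewrite invf_lt1// ltr1n.
have [|c] := MVT half0 (fun y _ => b' y).
  exact: continuous_subspaceT.
rewrite in_itv/= => /andP[c0 c1] bE.
have cN0 : dbump c != 0.
  apply/eqP => dc; have := @bump_half R.
  have b0 : bump01 (0 : R) = 0 by apply: bump_out; left.
  by move: bE; rewrite b0 dc mul0r subr0 => ->; rewrite ltxx.
apply: (@unit_integral_gt0 _ _ c); first exact: cmul.
- by move=> y; rewrite -expr2 sqr_ge0.
- by rewrite c0 (lt_trans c1).
- by rewrite -expr2 exprn_even_gt0.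
Qed.

Lemma unit_integral_dbump : unit_integral dbump = 0.
Proof.
transitivity (bump01 1 - bump01 0 : R).
  apply: (@unit_integral_derive _ _ (@bump01 R)) => // y.
  exact/elementary_is_derive/elementary_bump.
by rewrite !bump_out ?subrr//; [left|right].
Qed.

Lemma unit_integral_bump_dbump : unit_integral (fun y => bump01 y * dbump y) = 0.
Proof.
pose F (y : R) := 2^-1 * (bump01 y * bump01 y).
transitivity (F 1 - F 0).
  apply: unit_integral_derive => [|y]; first exact: cmul.
  have b' := elementary_is_derive y (@elementary_bump R).
  by apply: is_derive_eq; rewrite /GRing.scale/=; field.
by rewrite /F !bump_out ?mulr0 ?subrr//; [left|right].
Qed.

Lemma integral_bump_train h n a d k : 0 < h -> (k < n)%N ->
  \int[mu]_(x in cell h k) bump_train h n a d x = h * (a k * mass).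
Proof.
move=> h0 kn.
rewrite (@eq_Rintegral _ _ _ mu _
    (fun x => (fun y => a k * bump01 y + d k * dbump y) (x / h - k%:R))); last first.
  by move=> x /set_mem xk; rewrite (bump_train_cell _ _ h0 kn xk).
rewrite (@integral_cell_scale _ (fun y => a k * bump01 y + d k * dbump y)) //;
  last first.
  by apply: cadd; exact: cscale.
congr (_ * _); rewrite unit_integralD; [|exact: cscale..].
by rewrite !unit_integralZ// unit_integral_dbump mulr0 addr0.
Qed.

Lemma integral_bump_trainM h n a d b e k : 0 < h -> (k < n)%N ->
  \int[mu]_(x in cell h k) (bump_train h n a d x * bump_train h n b e x) =
  h * (a k * b k * energy + d k * e k * denergy).
Proof.
move=> h0 kn.
pose P y := a k * b k * (bump01 y * bump01 y) + ((a k * e k + d k * b k) *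
   (bump01 y * dbump y) + d k * e k * (dbump y * dbump y)).
rewrite (@eq_Rintegral _ _ _ mu _ (fun x => P (x / h - k%:R))); last first.
  move=> x /set_mem xk; rewrite !(bump_train_cell _ _ h0 kn xk) /P.
  by ring.
have c1 c : continuous (fun y : R => c * (bump01 y * bump01 y)) by exact/cscale/cmul.
have c2 c : continuous (fun y => c * (bump01 y * dbump y)) by exact/cscale/cmul.
have c3 c : continuous (fun y => c * (dbump y * dbump y)) by exact/cscale/cmul.
rewrite integral_cell_scale//; last by apply: cadd => //; exact: cadd.
congr (_ * _); rewrite /P unit_integralD//; last exact: cadd.
rewrite unit_integralD// !unit_integralZ//; [|exact: cmul..].
by rewrite unit_integral_bump_dbump mulr0 add0r.
Qed.

End BumpTrain.

(** * Scales and coefficients *)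

Section Scales.
Context {R : realType}.
Implicit Types e : R.

(** Pairing errors are of order [h * (n * h)] for [n] cells of width [h]. The
    length [n * h] has to exceed every fixed bound; with [1 / e] for this length
    the exponent 3 makes the errors [O(e ^ 2)]. *)
Definition width e : R := e ^+ 3.
Definition ncells e : nat := (Num.truncn (e ^- 4)).+1.

Lemma width_gt0 e : 0 < e -> 0 < width e.
Proof. by move=> e0; rewrite exprn_gt0. Qed.

Lemma count_width_ge e : 0 < e -> e^-1 <= (ncells e)%:R * width e.
Proof.
move=> e0; have e4 : 0 <= e ^- 4 by rewrite invr_ge0 exprn_ge0// ltW.
have /andP[_ /ltW tr] := truncn_itv e4.
apply: le_trans (ler_wpM2r (ltW (width_gt0 e0)) tr).
suff -> : e ^- 4 * width e = e^-1 by [].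
by rewrite /width; field; rewrite gt_eqF.
Qed.

Lemma count_width_le e : 0 < e <= 1 -> (ncells e)%:R * width e <= 2 / e.
Proof.
move=> /andP[e0 e1]; have e4 : 0 <= e ^- 4 by rewrite invr_ge0 exprn_ge0// ltW.
have /andP[tr _] := truncn_itv e4.
have : (ncells e)%:R <= e ^- 4 + 1 by rewrite /ncells -natr1 lerD2r.
move=> /(ler_wpM2r (ltW (width_gt0 e0)))/le_trans; apply.
suff -> : (e ^- 4 + 1) * width e = e^-1 + e ^+ 3.
  have : e ^+ 3 <= 1 by rewrite exprn_ile1// ltW.
  have : 1 <= e^-1 by rewrite invf_ge1.
  lra.
by rewrite /width; field; rewrite gt_eqF.
Qed.

Lemma near_count_width_ge (b : R) :
  \forall e \near 0^'+, b <= (ncells e)%:R * width e.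
Proof.
have b0 : 0 < `|b| + 1 by rewrite ltr_wpDl.
near=> e; have e0 : 0 < e by near: e; exact: nbhs_right_gt.
apply: le_trans (count_width_ge e0); apply: (@le_trans _ _ (`|b| + 1)).
  by rewrite (le_trans (ler_norm _))// lerDl.
rewrite -[leLHS]invrK lef_pV2 ?posrE ?invr_gt0//.
by near: e; apply: nbhs_right_le; rewrite invr_gt0.
Unshelve. all: by end_near. Qed.

Lemma near_width_lt (a : R) : 0 < a -> \forall e \near 0^'+, width e < a.
Proof.
move=> a0; near=> e; have e0 : 0 < e by near: e; exact: nbhs_right_gt.
apply: (@le_lt_trans _ _ e); last by near: e; exact: nbhs_right_lt.
have e1 : e <= 1 by near: e; exact: nbhs_right_le.
by rewrite /width exprS; apply: ler_piMr; [exact: ltW|apply: exprn_ile1; [exact: ltW|]].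
Unshelve. all: by end_near. Qed.

Lemma near_error_le (K d : R) : 0 <= K -> 0 < d ->
  \forall e \near 0^'+, K * width e * ((ncells e)%:R * width e) <= d * `|e|.
Proof.
move=> K0 d0; near=> e; have e0 : 0 < e by near: e; exact: nbhs_right_gt.
have e1 : e <= 1 by near: e; exact: nbhs_right_le.
have eK : e <= d / (2 * K + 1).
  by near: e; apply: nbhs_right_le; rewrite divr_gt0// ltr_wpDl// mulr_ge0.
rewrite (ger0_norm (ltW e0)).
have cw : (ncells e)%:R * width e <= 2 / e by apply: count_width_le; rewrite e0.
apply: (@le_trans _ _ (K * width e * (2 / e))).
  by apply: ler_wpM2l cw; rewrite mulr_ge0// ltW ?width_gt0.
have -> : K * width e * (2 / e) = (2 * K * e) * e.
  by rewrite /width; field; rewrite gt_eqF.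
rewrite ler_pM2r//; apply: (@le_trans _ _ (2 * K * (d / (2 * K + 1)))).
  by apply: ler_wpM2l eK; rewrite mulr_ge0.
have K1 : 0 < 2 * K + 1 by lra.
rewrite mulrA ler_pdivrMr// mulrC ler_wpM2l//; first exact: ltW.
by rewrite lerDl.
Unshelve. all: by end_near. Qed.

End Scales.

Section Coefficients.
Context {R : realType}.
Implicit Types (A B P : R).
Notation mu := (@completed_lebesgue_measure R).
Notation mass := (@mass R).
Notation energy := (@energy R).
Notation denergy := (@denergy R).

Definition cell_mean (f : R -> R) (h : R) (k : nat) : R :=
  (\int[mu]_(x in cell h k) f x) / (h * mass).

(** The common cell mean of the squares. The summand [denergy] guarantees that
    every [swing] is at least 1, which keeps [counterswing] bounded. *)
Definition level P : R := P ^+ 2 * energy + denergy.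

(** The coefficient of the oscillating profile that raises the mean of the square
    from [A ^ 2 * energy] to [level P]. *)
Definition swing P A : R := Num.sqrt ((level P - A ^+ 2 * energy) / denergy).

(** The coefficient that cancels the mean of the product of two trains; see
    [counterswing_balance]. *)
Definition counterswing P A B : R := - (A * B * energy) / (swing P A * denergy).

Lemma sqr_swing P A : `|A| <= P ->
  1 <= swing P A ^+ 2 <= level P / denergy /\
  A * A * energy + swing P A * swing P A * denergy = level P.
Proof.
move=> AP; have d0 := @denergy_gt0 R; have I0 := @energy_ge0 R.
have A2 : A ^+ 2 * energy <= P ^+ 2 * energy.
  by rewrite ler_wpM2r// -real_normK ?num_real// lerXn2r// ?nnegrE// (le_trans _ AP).
have A20 : 0 <= A ^+ 2 * energy by rewrite mulr_ge0// sqr_ge0.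
have q1 : 1 <= (level P - A ^+ 2 * energy) / denergy.
  by rewrite ler_pdivlMr// mul1r /level; lra.
have sE : swing P A ^+ 2 = (level P - A ^+ 2 * energy) / denergy.
  by rewrite /swing sqr_sqrtr// (le_trans ler01).
split; first by rewrite sE q1/= ler_pM2r ?invr_gt0// gerBl.
by rewrite -!expr2 sE; field; rewrite gt_eqF.
Qed.

Lemma swing_ge1 P A : `|A| <= P -> 1 <= swing P A.
Proof.
move=> /sqr_swing[/andP[s1 _] _].
by rewrite -(@ler_pXn2r _ 2)// ?nnegrE ?sqrtr_ge0// expr1n.
Qed.

Lemma normr_swing_le P A : `|A| <= P -> `|swing P A| <= level P / denergy.
Proof.
move=> AP; have s1 := swing_ge1 AP; have [/andP[_ sl] _] := sqr_swing AP.
have s0 := le_trans ler01 s1.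
by rewrite ger0_norm// (le_trans _ sl)// expr2 ler_peMr.
Qed.

Lemma counterswing_balance P A B : `|A| <= P ->
  B * A * energy + counterswing P A B * swing P A * denergy = 0.
Proof.
move=> AP; have s1 := swing_ge1 AP; rewrite /counterswing; field.
by rewrite !gt_eqF// ?denergy_gt0// (lt_le_trans ltr01).
Qed.

Lemma normr_counterswing_le P Q A B : `|A| <= P -> `|B| <= Q ->
  `|counterswing P A B| <= P * Q * energy / denergy.
Proof.
move=> AP BQ; have s1 := swing_ge1 AP; have d0 := @denergy_gt0 R.
have I0 := @energy_ge0 R; have s0 := lt_le_trans ltr01 s1.
rewrite /counterswing mulNr normrN normrM normfV !normrM (ger0_norm I0).
rewrite (gtr0_norm s0) (gtr0_norm d0).
apply: ler_pM; first by rewrite !mulr_ge0.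
- by rewrite invr_ge0 mulr_ge0// ltW.
- by apply: ler_wpM2r => //; exact: ler_pM.
- by rewrite lef_pV2 ?posrE ?mulr_gt0//; apply: ler_peMl => //; exact: ltW.
Qed.

Lemma normr_cell_mean_le f h k (M : R) : 0 < h ->
  lebesgue_measurable_fun (@halfline R) f ->
  (forall x, 0 <= x -> `|f x| <= M) -> `|cell_mean f h k| <= M / mass.
Proof.
move=> h0 mf fM; have m0 := @mass_gt0 R.
have kh : 0 <= k%:R * h by rewrite mulr_ge0// ltW.
have kk : k%:R * h <= k.+1%:R * h by rewrite ler_pM2r// ler_nat.
have fk x : k%:R * h <= x < k.+1%:R * h -> `|f x| <= M.
  by move=> /andP[kx _]; apply: fM; exact: le_trans kx.
have := normr_itv_integral_le kk (@lebesgue_measurable_itv _ f _ _ kh mf) fk.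
rewrite /cell_mean normrM normfV (gtr0_norm (mulr_gt0 h0 m0)) -/(cell h k) => le1.
rewrite ler_pdivrMr ?mulr_gt0//.
have -> : M / mass * (h * mass) = M * h by field; rewrite gt_eqF.
by move: le1; rewrite -natr1 mulrDl mul1r addrAC subrr add0r.
Qed.

End Coefficients.

(** * Asymptotic estimates *)

Section Asymptotics.
Context {R : realType}.
Implicit Types (e h x t d : R) (f g v r l w : R -> R).
Notation mu := (@completed_lebesgue_measure R).

(** The constants are uniform in [e], so [pairing_le] gives an error [O(e ^ 2)]. *)
Lemma near_pairing_le (g : R -> R -> R) psi (K L b : R) :
  0 <= K -> 0 <= L ->
  (forall e, 0 < e -> [/\ lebesgue_measurable_fun (@halfline R) (g e),
    forall x, 0 <= x -> `|g e x| <= K &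
    forall k, (k < ncells e)%N -> \int[mu]_(x in cell (width e) k) g e x = 0]) ->
  continuous psi -> (forall x, b < x -> psi x = 0) ->
  (forall x y, `|psi x - psi y| <= L * `|x - y|) ->
  forall d, 0 < d -> \forall e \near 0^'+,
    `|hintegral (fun x => g e x * psi x)| <= d * `|e|.
Proof.
move=> K0 L0 gP cpsi psi0 psiL d d0; near=> e.
have e0 : 0 < e by near: e; exact: nbhs_right_gt.
have [mg gK g0] := gP e e0.
have bn : b + 1 <= (ncells e)%:R * width e by near: e; exact: near_count_width_ge.
have small : K * L * width e * ((ncells e)%:R * width e) <= d * `|e|.
  by near: e; apply: near_error_le => //; exact: mulr_ge0.
apply: le_trans small; apply: pairing_le => //; first exact: width_gt0.
by move=> x nx; apply: psi0; lra.
Unshelve. all: by end_near. Qed.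

(** The oscillating profile has integral zero, so the cell means of the train are
    those of [f] for every choice of the coefficients [a]. *)
Lemma near_bump_train_approx f (M B : R) (a : R -> nat -> R) psi :
  lebesgue_measurable_fun (@halfline R) f ->
  (forall x, 0 <= x -> `|f x| <= M) -> 0 <= B ->
  (forall e k, 0 < e -> `|a e k| <= B) -> test_function psi ->
  forall d, 0 < d -> \forall e \near 0^'+,
    `|hintegral (fun x => (bump_train (width e) (ncells e)
        (cell_mean f (width e)) (a e) x - f x) * psi x)| <= d * `|e|.
Proof.
move=> mf fM B0 aB tpsi d d0.
have [A [b [L [/andP[A0 Ab] L0 [psi0 _] psiL _]]]] := test_function_lipschitz tpsi.
have [dpsi _ _] := tpsi.
have M0 : 0 <= M by apply: le_trans (fM 0 (lexx _)).
have [K K0 sK] := @bump_train_bounded R (M / mass) B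
  (divr_ge0 M0 (ltW (@mass_gt0 R))) B0.
apply: (@near_pairing_le (fun e x => bump_train (width e) (ncells e)
        (cell_mean f (width e)) (a e) x - f x) psi (K + M) L b) => //.
- by rewrite addr_ge0// ltW.
- move=> e e0; have h0 := width_gt0 e0.
  set s := bump_train _ _ _ _.
  have es : elementary s by exact: elementary_bump_train.
  have sb x : `|s x| <= K.
    apply: sK => // k _; first exact: normr_cell_mean_le.
    exact: aB.
  split.
  + apply: lebesgue_measurableB => //.
    exact/continuous_lebesgue_measurable/elementary_continuous.
  + move=> x x0; apply: le_trans (ler_normB _ _) _.
    by rewrite lerD// fM.
  + move=> k kn; have kh : 0 <= k%:R * width e by rewrite mulr_ge0// ltW.
    rewrite RintegralB//.
    * rewrite integral_bump_train// /cell_mean; apply/eqP; rewrite subr_eq0.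
      apply/eqP; field; rewrite !gt_eqF//; exact: mass_gt0.
    * by apply: measurable_LebesgueR; exact: measurable_itv.
    * exact/continuous_itv_integrable/elementary_continuous.
    * apply: (@bounded_itv_integrable _ _ _ M).
        exact: lebesgue_measurable_itv.
      by move=> x /andP[kx _]; apply: fM; exact: le_trans kx.
- exact: derivable_continuous (dpsi 0%N).
- by move=> x bx; apply: psi0; right.
Qed.

Lemma near_flux_le (G : R -> R -> R) phi (K : R) : 0 <= K ->
  (forall e, 0 < e -> [/\ elementary (G e),
    forall x, 0 <= x -> `|G e x| <= K &
    forall k, (k < ncells e)%N -> \int[mu]_(x in cell (width e) k) G e x = 0]) ->
  test_function phi ->
  forall d, 0 < d -> \forall e \near 0^'+,
    `|hintegral (fun x => derive1 (G e) x * phi x)| <= d * `|e|.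
Proof.
move=> K0 GP tphi d d0.
have [A [b [L [/andP[A0 Ab] L0 [_ phi'0] _ phi'L]]]] := test_function_lipschitz tphi.
have [dphi _ _] := tphi.
have cphi' : continuous (derive1 phi) := derivable_continuous (dphi 1%N).
near=> e; have e0 : 0 < e by near: e; exact: nbhs_right_gt.
have [eG _ _] := GP e e0.
rewrite integration_by_parts_test// normrN; near: e.
apply: (@near_pairing_le G (derive1 phi) K L b) => //.
- move=> e e0; have [eG GK G0] := GP e e0; split=> //.
  exact/continuous_lebesgue_measurable/elementary_continuous.
- by move=> x bx; apply: phi'0; right.
Unshelve. all: by end_near. Qed.

End Asymptotics.

(** * The boundary layer *)

Section BoundaryLayer.
Context {R : realType}.
Implicit Types (e h x t d : R) (f g v r l w : R -> R).

(** The bump recentred at [x = 0], where it is normalized to 1. *)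
Definition layer h x : R := (bump01 2^-1)^-1 * bump01 (x / h - - 2^-1).

Lemma elementary_layer h : elementary (layer h).
Proof.
apply: elementaryM; first exact: elementary_cst.
exact/elementary_rescale/elementary_bump.
Qed.

Lemma layer0 h : layer h 0 = 1.
Proof. by rewrite /layer mul0r sub0r opprK mulVf// gt_eqF// bump_half. Qed.

Lemma layer_far h x : 0 < h -> h <= x -> layer h x = 0.
Proof.
move=> h0 hx; have xh : 1 <= x / h by rewrite ler_pdivlMr// mul1r.
by rewrite /layer (@bump_out _ (_ - _)) ?mulr0//; right; lra.
Qed.

(** [v] is the stationary interior part and [w] the trace on the boundary. *)
Definition layered h w v (p : R * R) : R := layer h p.1 * w p.2 + v p.1.

Lemma smooth_layered h w v : elementary w -> elementary v ->
  smooth_quadrant (layered h w v).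
Proof.
move=> ew ev n.
apply: (@tensor_C_quadrant _ n 2 (fun i => if i == 0 then layer h else v)
  (fun i => if i == 0 then w else fun=> 1)).
- by move=> i; case: ifP => // _; exact: elementary_layer.
- by move=> i; case: ifP => // _; exact: elementary_cst.
- by move=> p _; rewrite /tensor big_ord_recl big_ord1/= mulr1.
Qed.

Lemma layered_init h w v x : w 0 = 0 -> layered h w v (x, 0) = v x.
Proof. by move=> w0; rewrite /layered/= w0 mulr0 add0r. Qed.

Lemma layered_bdry h w v t : v 0 = 0 -> layered h w v (0, t) = w t.
Proof. by move=> v0; rewrite /layered/= layer0 mul1r v0 addr0. Qed.

Lemma layered_far h w v x t : 0 < h -> h <= x -> layered h w v (x, t) = v x.
Proof. by move=> h0 hx; rewrite /layered/= layer_far// mul0r add0r. Qed.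

Lemma dx_near (F : R * R -> R) f x t : 0 <= x -> elementary f ->
  (\forall y \near x, F (y, t) = f y) -> dx F (x, t) = derive1 f x.
Proof.
move=> x0 ef Ff.
have F' : is_derive x 1 (fun y => F (y, t)) (derive1 f x).
  apply: (@near_eq_is_derive _ _ _ f); last exact: elementary_is_derive.
  by near=> y; apply/esym; near: y.
by have [_] := hderive_is_derive x0 (fun y _ => erefl (F (y, t))) F'.
Unshelve. all: by end_near. Qed.

Lemma dx_layered_far h w v x t : 0 < h -> h < x -> elementary v ->
  dx (layered h w v) (x, t) = derive1 v x.
Proof.
move=> h0 hx ev; apply: dx_near => //; first by rewrite ltW// (lt_trans h0).
by near=> y; rewrite layered_far// ltW//; near: y; exact: lt_nbhsr.
Unshelve. all: by end_near. Qed.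

Lemma dx_layeredM_far h w1 v1 w2 v2 x t : 0 < h -> h < x ->
  elementary v1 -> elementary v2 ->
  dx (layered h w1 v1 \* layered h w2 v2) (x, t) =
  derive1 (fun y => v1 y * v2 y) x.
Proof.
move=> h0 hx ev1 ev2; apply: dx_near; first by rewrite ltW// (lt_trans h0).
  exact: elementaryM.
near=> y; have hy : h <= y by rewrite ltW//; near: y; exact: lt_nbhsr.
by rewrite /= !layered_far.
Unshelve. all: by end_near. Qed.

Lemma dt_layered_far h w v x t : 0 < h -> h < x -> 0 <= t ->
  dt (layered h w v) (x, t) = 0.
Proof.
move=> h0 hx t0; have vt : {in @halfline R,
    (fun s => layered h w v (x, s)) =1 (fun=> v x)}.
  by move=> s _; rewrite layered_far// ltW.
by have [_] := hderive_is_derive t0 vt (is_derive_cst (v x) t 1).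
Qed.

End BoundaryLayer.

(** * Existence of a weak asymptotic solution *)

Lemma near_littleo (R : realType) (F : R -> R) :
  (forall d, 0 < d -> \forall e \near 0^'+, `|F e| <= d * `|e|) ->
  F =o_ (0^'+) id.
Proof. by move=> H; apply/eqoP => d d0; exact: H. Qed.

Lemma bounded_halfline (R : realType) (f : R -> R) : [bounded f x | x in @halfline R] ->
  exists2 M : R, 0 <= M & forall x, 0 <= x -> `|f x| <= M.
Proof.
move=> [M [_ fM]]; exists (`|M| + 1) => [|x x0]; first by rewrite addr_ge0.
apply: fM; first by rewrite (le_lt_trans (ler_norm _))// ltrDl.
by rewrite /halfline/= in_itv/= x0.
Qed.

Theorem theorem2p1 (R : realType) (u0 rho0 uB rhoB : R -> R)
    (mu0 : lebesgue_measurable_fun (@halfline R) u0)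
    (mrho0 : lebesgue_measurable_fun (@halfline R) rho0)
    (muB : lebesgue_measurable_fun (@halfline R) uB)
    (mrhoB : lebesgue_measurable_fun (@halfline R) rhoB)
    (bu0 : [bounded u0 x | x in @halfline R])
    (brho0 : [bounded rho0 x | x in @halfline R])
    (buB : [bounded uB t | t in @halfline R])
    (brhoB : [bounded rhoB t | t in @halfline R])
    (irho0 : lebesgue_integrable (@halfline R) rho0) :
  exists u rho : R -> R * R -> R,
    weak_asymptotic_solution u rho u0 rho0 uB rhoB.
Proof.
move: bu0 brho0 buB brhoB => /bounded_halfline[M M0 u0M]
  /bounded_halfline[N N0 rho0N] /bounded_halfline[MB _ uBM]
  /bounded_halfline[NB _ rhoBN].
have m0 := @mass_gt0 R; have d0 := @denergy_gt0 R; have I0 := @energy_ge0 R.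
pose P := M / (@mass R); pose Q := N / @mass R.
have P0 : 0 <= P by rewrite divr_ge0// ltW.
have Q0 : 0 <= Q by rewrite divr_ge0// ltW.
pose A e := cell_mean u0 (width e).
pose B e := cell_mean rho0 (width e).
pose D e k := swing P (A e k).
pose E e k := counterswing P (A e k) (B e k).
pose v e := bump_train (width e) (ncells e) (A e) (D e).
pose r e := bump_train (width e) (ncells e) (B e) (E e).
pose wu e := bump_train (width e) (ncells e) (cell_mean uB (width e)) (fun=> 0).
pose wr e := bump_train (width e) (ncells e) (cell_mean rhoB (width e)) (fun=> 0).
have AP e k : 0 < e -> `|A e k| <= P.
  by move=> e0; apply: normr_cell_mean_le => //; exact: width_gt0.
have BQ e k : 0 < e -> `|B e k| <= Q.
  by move=> e0; apply: normr_cell_mean_le => //; exact: width_gt0.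
have l0 : 0 <= level P / (@denergy R).
  by apply: le_trans (normr_ge0 _) (@normr_swing_le _ P 0 _); rewrite normr0.
have q0 : 0 <= P * Q * (@energy R) / (@denergy R).
  by apply: divr_ge0 (ltW d0); apply: mulr_ge0 I0; exact: mulr_ge0.
have DP e k : 0 < e -> `|D e k| <= level P / (@denergy R).
  by move=> e0; apply: normr_swing_le; exact: AP.
have EP e k : 0 < e -> `|E e k| <= P * Q * (@energy R) / (@denergy R).
  by move=> e0; apply: normr_counterswing_le; [exact: AP|exact: BQ].
have [K K0 vK] := @bump_train_bounded R P _ P0 l0.
have [L L0 rL] := @bump_train_bounded R Q _ Q0 q0.
have {}vK e x : 0 < e -> `|v e x| <= K.
  move=> e0; apply: vK; [exact: width_gt0|by move=> k _; exact: AP|].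
  by move=> k _; exact: DP.
have {}rL e x : 0 < e -> `|r e x| <= L.
  move=> e0; apply: rL; [exact: width_gt0|by move=> k _; exact: BQ|].
  by move=> k _; exact: EP.
have ev e : elementary (v e) by exact: elementary_bump_train.
have er e : elementary (r e) by exact: elementary_bump_train.
have ewu e : elementary (wu e) by exact: elementary_bump_train.
have ewr e : elementary (wr e) by exact: elementary_bump_train.
have stair0 e a b : 0 < e -> bump_train (width e) (ncells e) a b 0 = 0.
  by move=> e0; rewrite bump_train_le0//; exact: width_gt0.
exists (fun e => layered (width e) (wu e) (v e)).
exists (fun e => layered (width e) (wr e) (r e)).
split.
- by move=> e _; split; exact: smooth_layered.
- move=> phi tphi T T0 d dpos.
  (* Without the constant, the flux would not have mean zero on the cells. *)
  pose G e x := 2^-1 * (v e x * v e x) + - (2^-1 * level P).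
  have eG e : elementary (G e).
    apply: elementaryD; last exact: elementary_cst.
    by apply: elementaryM; [exact: elementary_cst|exact: elementaryM].
  have G' e x : derive1 (G e) x = v e x * derive1 (v e) x.
    have v' := elementary_is_derive x (ev e).
    rewrite derive1E; apply: derive_val.
    by apply: is_derive_eq; rewrite /GRing.scale/=; field.
  have lev0 : 0 <= level P by apply: addr_ge0 (ltW d0); apply: mulr_ge0 I0; exact: sqr_ge0.
  have G0 := @near_flux_le R G phi (K * K + level P).
  have [a [b [_ [/andP[a0 _] _ [phi0 _] _ _]]]] := test_function_lipschitz tphi.
  near=> e => t /=; rewrite in_itv/= => /andP[t0 _].
  have e0 : 0 < e by near: e; exact: nbhs_right_gt.
  have h0 := width_gt0 e0.
  have ha : width e < a by near: e; exact: near_width_lt.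
  (* The layer has left the support of phi, so only v remains. *)
  rewrite (_ : hintegral _ = hintegral (fun x => derive1 (G e) x * phi x)).
    near: e; apply: G0 => //; first by rewrite addr_ge0// mulr_ge0// ltW.
    move=> e e0; split => //.
    + move=> x _; apply: le_trans (ler_normD _ _) _; rewrite normrN.
      have half : `|2^-1 : R| <= 1 by rewrite ger0_norm// invf_le1// ler1n.
      rewrite lerD//.
        rewrite normrM -[leRHS]mul1r ler_pM// normrM ler_pM//; exact: vK.
      by rewrite normrM (ger0_norm lev0) ler_piMl.
    + move=> k kn; have h0 := width_gt0 e0.
      have cvv : continuous (fun x => v e x * v e x).
        by apply: elementary_continuous; exact: elementaryM.
      have c2 (c : R) : continuous (fun _ : R => c) by exact: cst_continuous.
      have mI : measurable (cell (width e) k : set (LebesgueR R)).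
        by apply: measurable_LebesgueR; exact: measurable_itv.
      have kk : k%:R * width e <= k.+1%:R * width e.
        by rewrite ler_pM2r// ler_nat.
      rewrite RintegralD//; first last.
      * exact: continuous_itv_integrable.
      * apply: continuous_itv_integrable => x.
        by apply: cvgM; [exact: c2|exact: cvv].
      rewrite RintegralZl//; last exact: continuous_itv_integrable.
      rewrite integral_bump_trainM// Rintegral_cst//.
      have -> := congr1 fine (completed_lebesgue_itv kk).
      have [_ ->] := sqr_swing (AP e k e0).
      by rewrite /= -natr1; ring.
  apply: eq_Rintegral => x /set_mem; rewrite /halfline/= in_itv/= andbT => x0.
  have [xa|ax] := ltP x a; first by rewrite phi0 ?mulr0//; left.
  have hx := lt_le_trans ha ax.
  by rewrite dt_layered_far// dx_layered_far// layered_far ?ltW// add0r G'.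
- move=> phi tphi T T0 d dpos.
  pose G e x := r e x * v e x.
  have eG e : elementary (G e) by exact: elementaryM.
  have G0 := @near_flux_le R G phi (L * K).
  have [a [b [_ [/andP[a0 _] _ [phi0 _] _ _]]]] := test_function_lipschitz tphi.
  near=> e => t /=; rewrite in_itv/= => /andP[t0 _].
  have e0 : 0 < e by near: e; exact: nbhs_right_gt.
  have h0 := width_gt0 e0.
  have ha : width e < a by near: e; exact: near_width_lt.
  rewrite (_ : hintegral _ = hintegral (fun x => derive1 (G e) x * phi x)).
    near: e; apply: G0 => //; first by rewrite mulr_ge0// ltW.
    move=> e e0; split => //.
    + by move=> x _; rewrite normrM ler_pM//; [exact: rL|exact: vK].
    + move=> k kn; rewrite integral_bump_trainM//; last exact: width_gt0.
      by rewrite counterswing_balance ?mulr0//; exact: AP.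
  apply: eq_Rintegral => x /set_mem; rewrite /halfline/= in_itv/= andbT => x0.
  have [xa|ax] := ltP x a; first by rewrite phi0 ?mulr0//; left.
  have hx := lt_le_trans ha ax.
  by rewrite dt_layered_far// dx_layeredM_far// add0r.
- move=> psi tpsi; split; apply: near_littleo => d dpos.
  + near=> e; have e0 : 0 < e by near: e; exact: nbhs_right_gt.
    rewrite (_ : (fun x => _) = fun x => (v e x - u0 x) * psi x); last first.
      by apply/funext => x; rewrite layered_init//; exact: stair0.
    by near: e; apply: (@near_bump_train_approx _ u0 M _ D psi mu0 u0M l0).
  + near=> e; have e0 : 0 < e by near: e; exact: nbhs_right_gt.
    rewrite (_ : (fun x => _) = fun x => (r e x - rho0 x) * psi x); last first.
      by apply/funext => x; rewrite layered_init//; exact: stair0.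
    by near: e; apply: (@near_bump_train_approx _ rho0 N _ E psi mrho0 rho0N q0).
- move=> psi tpsi; split; apply: near_littleo => d dpos.
  + near=> e; have e0 : 0 < e by near: e; exact: nbhs_right_gt.
    rewrite (_ : (fun x => _) = fun x => (wu e x - uB x) * psi x); last first.
      by apply/funext => x; rewrite layered_bdry//; exact: stair0.
    near: e; apply: (@near_bump_train_approx _ uB MB 0 (fun _ _ => 0)) => //.
    by move=> *; rewrite normr0.
  + near=> e; have e0 : 0 < e by near: e; exact: nbhs_right_gt.
    rewrite (_ : (fun x => _) = fun x => (wr e x - rhoB x) * psi x); last first.
      by apply/funext => x; rewrite layered_bdry//; exact: stair0.
    near: e; apply: (@near_bump_train_approx _ rhoB NB 0 (fun _ _ => 0)) => //.
    by move=> *; rewrite normr0.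
Unshelve. all: by end_near. Qed.
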